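(* Given any fundamental line $\underline{AB}$ and any non end-point $C$ within it, the existence of two fundamental lines $\underline{AC}$ and $\underline{CB}$, within $\underline{AB}$, together constituted out of all and only the elements of $\underline{AB}$, and having no point in common except $C$, can be asserted.
   Context: A point is an object having no parts. An array is any collection of well-formed objects of the calculus. An object is given if its existence has been asserted. Points have dimension $0$; a seriate set of objects of dimension $N$, and the object it constitutes, both have dimension $N+1$; objects are like if they have the same dimension. An element of an object is a member of the seriate set that constitutes it. An object or set is within another if every element or member of the first is an element or member of the second; a point is within a line if it is an element of it. Objects with different names are assumed non-identical unless the contrary is stipulated or proved. Axiom of Existence: the existence of an object can be asserted if that existence does not entail ''not $A$'', where $A$ is any proposition entailed by any characteristic of any array of which the object is asserted to be a part; it can be negatived if it does entail such a ''not $A$''. Seriate set: a set of more than two like objects is a seriate set $S$ if and only if (a) no part of any member of $S$ is a part of any other member of $S$; and (b) $S$ has exactly two members called its ''E'' objects, all other members being called its ''I'' objects, such that, given the existence of $S$ and given any ''I'' object $X$ of $S$, the existence can be asserted of a set $\mathcal{S}$ of seriate sets such that: (i) the set of all members of all the seriate sets in $\mathcal{S}$ is identical to the set of members of $S$; (ii) no member of a seriate set in $\mathcal{S}$ is a member of any other seriate set in $\mathcal{S}$ unless it is an ''E'' object of the former; (iii) exactly two of all the ''E'' objects of all the seriate sets in $\mathcal{S}$ are members of no other seriate set in $\mathcal{S}$, and these two are the two ''E'' objects of $S$; (iv) every other ''E'' object of a seriate set in $\mathcal{S}$ is a member of exactly two seriate sets in $\mathcal{S}$, and $X$ is identical to such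 an ''E'' object; (v) no subset of $\mathcal{S}$ is such that each of the ''E'' objects of every member of that subset is a member of another seriate set of that subset. Axiom of Identity: one set is identical to another if it is not possible to distinguish the membership of one from the membership of the other. Axiom of Stability: if, given a seriate set $S$, the existence of a seriate set $T$ within $S$ can be asserted, then the existence cannot be asserted of any other seriate set within $S$ which has the same ''E'' objects as $T$ and is constituted by a set of objects not identical to the set of objects which constitutes $T$. Fundamental line: a seriate set of points constitutes a fundamental line, whose end-points are the ''E'' objects of that seriate set. $\underline{AB}$ denotes a fundamental line with end-points $A$ and $B$. *)

(* Defs.v *)
From HB Require Import structures.
From mathcomp Require Import all_boot.
From mathcomp Require Import boolp classical_sets functions cardinality.

Set Implicit Arguments.
Unset Strict Implicit.
Unset Printing Implicit Defensive.

Local Open Scope classical_set_scope.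
Local Open Scope card_scope.

(* A figure is only a candidate: a set of like objects with the set of its "E"
   objects. It is not assumed to be seriate, and the "E" objects are
   unordered. *)
Record figure (T : Type) : Type := Figure {
  elements : set T;
  E_objects : set T
}.

(* [obj P n] is the type of candidate objects of dimension [n] over a type [P]
   of points; two objects are like when they live in the same [obj P n]. The
   Axiom of Identity is extensionality of sets. *)
Fixpoint obj (P : Type) (n : nat) : Type :=
  if n is m.+1 then figure (obj P m) else P.

Definition object (P : Type) : Type := {n : nat & obj P n}.

Definition mk (P : Type) (n : nat) (o : obj P n) : object P :=
  existT (obj P) n o.

Definition array (P : Type) : Type := set (object P).

(* The parts of an object are its elements and the parts of its elements;
   points have none. *)
Inductive part (P : Type) : object P -> object P -> Prop :=
| part_element n (x : obj P n) (o : obj P n.+1) :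
    elements o x -> part (mk x) (mk o)
| part_part (p : object P) n (x : obj P n) (o : obj P n.+1) :
    part p (mk x) -> elements o x -> part p (mk o).

Definition I_objects (T : Type) (S : figure T) : set T :=
  elements S `\` E_objects S.

Definition within (T : Type) (S S' : figure T) : Prop :=
  elements S `<=` elements S'.

(* Clauses (i)-(v) in the definition of a seriate set. In (v) the subset has
   to be nonempty, since the empty subset has the excluded property
   vacuously. *)
Record decomposition (T : Type) (S : figure T) (X : T) (D : set (figure T)) :
    Prop := Decomposition {
  decomp_cover : \bigcup_(U in D) elements U = elements S;
  decomp_meet : forall U V : figure T, D U -> D V -> U <> V ->
    elements U `&` elements V `<=` E_objects U;
  decomp_ends :
    [set x | exists U, [/\ D U, E_objects U x
      & forall V, D V -> elements V x -> V = U]] = E_objects S;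
  decomp_links : forall (U : figure T) (x : T),
    D U -> E_objects U x -> ~ E_objects S x ->
    exists V V' : figure T, V <> V' /\
      [set W | D W /\ elements W x] = [set V; V'];
  decomp_at : exists U : figure T,
    [/\ D U, E_objects U X & ~ E_objects S X];
  decomp_no_cycle : ~ exists D' : set (figure T),
    [/\ D' !=set0, D' `<=` D
      & forall U x, D' U -> E_objects U x ->
          exists V, [/\ D' V, V <> U & elements V x]]
}.

(* Axiom of Existence, relative to a collection [K] of arrays regarded as free
   of contradiction: given [G], the existence of the objects of [H] can be
   asserted when some array of [K] comprises [G] and [H]. *)
Definition assertable_wrt (P : Type) (K : set (array P)) (G H : array P) :
    Prop :=
  exists W : array P, [/\ K W, G `<=` W & H `<=` W].

Record seriate_wrt (P : Type) (K : set (array P)) (G : array P) (n : nat)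
    (S : obj P n.+1) : Prop := SeriateWrt {
  seriate_card : `I_3 #<= elements S;
  seriate_no_common_part : forall X Y : obj P n,
    elements S X -> elements S Y -> X <> Y ->
    forall p : object P, ~ (part p (mk X) /\ part p (mk Y));
  seriate_ends : exists A B : obj P n, A <> B /\ E_objects S = [set A; B];
  seriate_ends_in : E_objects S `<=` elements S;
  seriate_split : forall X : obj P n, I_objects S X ->
    exists D : set (obj P n.+1),
      assertable_wrt K G [set mk T | T in D] /\ decomposition S X D
}.

(* Axiom of Stability, read jointly: once [T] within [S] is given, no other [T']
   within [S] with the same "E" objects can be given as well. *)
Definition stable (P : Type) (W : array P) : Prop :=
  forall n (S T T' : obj P n.+1),
    W (mk S) -> W (mk T) -> W (mk T') ->
    within T S -> within T' S -> E_objects T = E_objects T' ->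
    elements T = elements T'.

Definition admissible (P : Type) (K : set (array P)) (W : array P) : Prop :=
  [/\ forall n (S : obj P n.+1) (x : obj P n),
        W (mk S) -> elements S x -> W (mk x),
      forall n (S : obj P n.+1), W (mk S) -> seriate_wrt K W S
    & stable W].

(* The definition of a seriate set refers to seriate sets. Consistency is the
   greatest fixed point of [admissible] (see [consistentE]); under a least
   fixed point no set would be seriate, because a seriate set has to be
   decomposable again and again. *)
Definition consistent (P : Type) (W : array P) : Prop :=
  exists K : set (array P), K `<=` admissible K /\ K W.

Definition can_assert (P : Type) (G H : array P) : Prop :=
  assertable_wrt (@consistent P) G H.

Definition seriate (P : Type) (n : nat) (S : obj P n.+1) : Prop :=
  seriate_wrt (@consistent P) [set mk S] S.

Definition fundamental_line (P : Type) (L : obj P 1) (A B : P) : Prop :=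
  seriate L /\ E_objects L = [set A; B].

Lemma seriate_wrtW (P : Type) (K K' : set (array P)) (G G' : array P) n
    (S : obj P n.+1) :
  K `<=` K' -> G' `<=` G -> seriate_wrt K G S -> seriate_wrt K' G' S.
Proof.
move=> KK' G'G [c a e i sp]; split=> // X /sp[D [[W [KW GW HW]] dec]].
by exists D; split=> //; exists W; split; [exact: KK'|exact: subset_trans GW|].
Qed.

Lemma consistentE (P : Type) : @consistent P = admissible (@consistent P).
Proof.
have sub : @consistent P `<=` admissible (@consistent P).
  move=> W [K [adm KW]]; have [cl ser st] := adm _ KW; split=> // n S WS.
  by apply: seriate_wrtW (ser _ _ WS) => // V KV; exists K.
apply/seteqP; split=> // W [cl ser st].
exists (admissible (@consistent P)); split; last by split.
move=> V [cl' ser' st']; split=> // n S VS.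
exact: seriate_wrtW (ser' _ _ VS).
Qed.

Lemma consistent_seriate (P : Type) (W : array P) n (S : obj P n.+1) :
  consistent W -> W (mk S) -> seriate S.
Proof.
rewrite consistentE => -[_ ser _] WS.
by apply: seriate_wrtW (ser _ _ WS) => // _ ->.
Qed.

(* Main.v *)
Require Import Defs.
From mathcomp Require Import all_boot.
From mathcomp Require Import boolp classical_sets functions cardinality.
From mathcomp Require Import finmap zify.

Set Implicit Arguments.
Unset Strict Implicit.
Unset Printing Implicit Defensive.

Local Open Scope classical_set_scope.
Local Open Scope card_scope.

(* Only the endpoints and the infinitude of [AB] matter. A finite seriate set
   would have a decomposition into strictly smaller ones, so the set of points
   of [AB] is infinite, by descent. Conversely, let a ranking [h : P -> nat]
   and a set [V] of vertices be such that a vertex shares its rank with no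
   other point, every other point shares its rank with infinitely many, and
   some non-vertex has rank strictly between those of any two vertices. The
   array of all points of [AB] and all rank intervals with ends in [V] is
   stable, and to make any point [X] a vertex it suffices to multiply the ranks
   by 3 and to send the class of [X], split into two infinite sets and [X], to
   the three consecutive ranks so created; the old intervals do not change.
   Hence every interval can be cut at every point, and the collection of these
   arrays is free of contradiction. Starting from the vertices [A] and [B] and
   making [C] a vertex gives [AC] and [CB]. *)

(** * Finite and infinite sets *)

Lemma finite_set_proper_ind (T : Type) (Q : set T -> Prop) :
  (forall A, finite_set A -> (forall B, B `<` A -> Q B) -> Q A) ->
  forall A, finite_set A -> Q A.
Proof.
elim/Pchoice: T => T in Q *.
move=> IH A; have [n] := ubnP #|` fset_set A|.
elim: n A => // n IHn A ltAn finA; apply: IH => // B ltBA.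
have finB : finite_set B by apply: sub_finite_set finA; case: ltBA.
apply: IHn => //; rewrite ltnS in ltAn; apply: leq_trans ltAn.
apply: fproper_ltn_card; rewrite fproperEneq.
case: ltBA => BA nAB; apply/andP; split; last by rewrite -fset_set_sub.
apply/eqP => /(congr1 (fun X => [set` X])); rewrite !fset_setK // => E.
by apply: nAB; rewrite E.
Qed.

Lemma card_le_set2 (T : Type) (x y : T) : [set x; y] #<= `I_2.
Proof.
have -> : [set x; y] = (fun i => if i is 0 then x else y) @` `I_2.
  apply/seteqP; split=> [z [->|->]|z [[|i] _ <-]];
    [by exists 0|by exists 1|by left|by right].
exact: card_image_le.
Qed.

(** An injection of [nat] into [A] separates the images of the even numbers from those of the odd
    numbers. *)
Lemma infinite_set_split (T : Type) (A : set T) : infinite_set A ->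
  exists B, [/\ B `<=` A, infinite_set B & infinite_set (A `\` B)].
Proof.
elim/Ppointed: T => T in A *.
  by rewrite emptyE => /(_ (finite_set0 _)).
move=> /infiniteP/ppcard_leP[f].
have finj i j : f i = f j -> i = j.
  by move=> e; apply: (@inj _ _ _ f) => //; rewrite in_setT.
have infim g : injective g -> infinite_set [set f (g i) | i in [set: nat]].
  move=> ginj; apply/infiniteP.
  suff : [set: nat] #= [set f (g i) | i in [set: nat]].
    by rewrite card_eq_le => /andP[].
  by apply/card_esym/inj_card_eq => i j _ _ /finj/ginj.
exists [set f i.*2 | i in [set: nat]]; split.
- by move=> _ [i _ <-]; exact: funS.
- by apply: (infim double); exact: double_inj.
- have odd_inj : injective (fun i => i.*2.+1).
    by move=> i j []; exact: double_inj.
  apply: sub_infinite_set (infim _ odd_inj) => _ [i _ <-]; split.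
    exact: funS.
  by move=> [j _ /finj]; lia.
Qed.

(** * Seriate sets of points are infinite *)

Lemma no_part_point (P : Type) (p : object P) (x : P) : ~ part p (@mk P 0 x).
Proof.
have np o : part p o -> projT1 o <> 0 by case.
by move=> /np.
Qed.

(** Induction on the set of elements: clause (iv) gives two distinct seriate sets through an inner
    object [X], and the first is strictly smaller. *)
Lemma seriate_infinite (P : Type) (n : nat) (S : obj P n.+1) :
  seriate S -> infinite_set (elements S).
Proof.
move=> + finS; move: {-2}(elements S) (erefl (elements S)) finS => A + finA.
move: A finA S; apply: finite_set_proper_ind => A finA IH S eqSA serS.
have [card3 _ [a [b [_ Eab]]] _ split] := serS.
have not_sub2 (R : obj P n.+1) : seriate R -> ~ elements R `<=` E_objects R.
  move=> [cR _ [x [y [_ ->]]] _ _] /subset_card_le RE.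
  have := card_le_trans cR (card_le_trans RE (card_le_set2 x y)).
  by rewrite card_le_II.
have [X [SX nEX]] : exists X, I_objects S X.
  apply: contrapT => noI; apply: (not_sub2 S serS) => x Sx.
  by apply: contrapT => nEx; apply: noI; exists x.
have [D [[W [conW _ DW]] dec]] := split X (conj SX nEX).
have serD U : D U -> seriate U.
  by move=> DU; apply: consistent_seriate conW _; apply: DW; exists U.
have [U0 [DU0 EX nESX]] := decomp_at dec.
have [V [V' [neqV eqV]]] := decomp_links dec DU0 EX nESX.
have [DV VX] : D V /\ elements V X.
  by have : [set V; V'] V by [left]; rewrite -eqV.
have [DV' V'X] : D V' /\ elements V' X.
  by have : [set V; V'] V' by [right]; rewrite -eqV.
have subS U : D U -> elements U `<=` elements S.
  by move=> DU x Ux; rewrite -(decomp_cover dec); exists U.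
apply: (IH (elements V) _ V erefl (serD _ DV)); rewrite eqSA.
split; first exact: subS.
(* Otherwise [V'] lies in [V], and clause (ii) leaves it nothing but its two [E_objects]. *)
move=> SV; apply: (not_sub2 V' (serD _ DV')) => x V'x.
apply: (decomp_meet dec DV' DV) => //; first exact: nesym.
by split=> //; apply: SV; apply: subS V'x.
Qed.

(** * Rankings, their refinements and their intervals *)

Section Ranking.
Variables (P : Type) (S : set P).
Implicit Types (h : P -> nat) (V : set P).

Definition interval h (u v : P) : obj P 1 :=
  Figure [set x | S x /\ h u <= h x <= h v] [set u; v].

(** Equal rank means not yet separated. [class_infinite] leaves every class of non-vertices large
    enough to be split again. *)
Record ranking h V : Prop := Ranking {
  vertex_in : V `<=` S;
  vertex_alone : forall v x, V v -> S x -> h x = h v -> x = v;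
  class_infinite : forall x, S x -> ~ V x ->
    infinite_set [set y | S y /\ h y = h x];
  between : forall u v, V u -> V v -> h u < h v ->
    exists x, [/\ S x, ~ V x & h u < h x < h v]
}.

(** The strict inequality orients each pair of ends, so that the unordered [E_objects] determine an
    interval. *)
Definition ranked_array h V : array P := fun o =>
  let: existT n x := o in
  match n return obj P n -> Prop with
  | 0 => S
  | 1 => fun L => exists u v, [/\ V u, V v, h u < h v & L = interval h u v]
  | _ => fun=> False
  end x.

(** The last clause equates the old intervals as figures, so the old array is contained in the new
    one. *)
Lemma ranking_refine h V X : ranking h V -> S X ->
  exists h' V', [/\ ranking h' V', V `<=` V', V' X
    & forall u v, V u -> V v -> (h' u < h' v) = (h u < h v) /\
        interval h' u v = interval h u v].
Proof.
move=> rk SX; have [nVX|VX] := pselect (~ V X); last first.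
  by exists h, V; split=> //; exact: contrapT.
have [VS alone inf btw] := rk.
set F := [set y | S y /\ h y = h X].
have infF : infinite_set (F `\` [set X]).
  by apply: infinite_setD; [exact: inf|exact: finite_set1].
have [F1 [F1F infF1 infF2]] := infinite_set_split infF.
set F2 := (F `\` [set X]) `\` F1 in infF2.
(* [c] is the offset within tripled ranks: 0 on [F1], 1 at [X], 2 on [F2]. The final 0 is for points
   outside the class [F]. *)
pose c x := if pselect (x = X) then 1
            else if pselect (F1 x) then 0 else if pselect (F2 x) then 2 else 0.
have cX : c X = 1 by rewrite /c; case: pselect.
have cF1 x : F1 x -> c x = 0.
  rewrite /c => F1x; case: pselect => [xX|?]; last by case: pselect.
  by case: (F1F _ F1x) => _ [].
have cF2 x : F2 x -> c x = 2.
  by rewrite /c => F2x; do !case: pselect => // ?; case: F2x => -[].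
have cF x : ~ F x -> c x = 0.
  rewrite /c => nFx; case: pselect => [xX|?]; first by case: nFx; rewrite xX.
  by case: pselect => [/F1F[]//|?]; case: pselect => // -[[]].
have FP x : F x -> [\/ x = X, F1 x | F2 x].
  move=> Fx; have [->|xX] := pselect (x = X); first by constructor 1.
  by have [F1x|nF1x] := pselect (F1 x); [constructor 2|constructor 3].
have c_le2 x : c x <= 2 by rewrite /c; do !case: pselect => // ?.
have VF v : V v -> ~ F v.
  by move=> Vv [Sv /esym hvX]; apply: nVX; rewrite (alone v X).
have cV v : V v -> c v = 0 by move=> /VF/cF.
pose h' x := 3 * h x + c x.
have [x1 F1x1] := infinite_setN0 infF1.
have [x2 F2x2] := infinite_setN0 infF2.
have nV1 : ~ V x1 by move=> /VF; apply; case: (F1F _ F1x1).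
have nV2 : ~ V x2 by move=> /VF; apply; case: F2x2 => -[].
have [[Sx1 hx1] nX1] := F1F _ F1x1.
have [[[Sx2 hx2] nX2] _] := F2x2.
have c1 := cF1 _ F1x1; have c2 := cF2 _ F2x2.
exists h', (X |` V); split; [split| | |].
- by move=> v [->//|/VS].
- move=> v x [->|Vv] Sx; rewrite /h' ?cX ?(cV _ Vv) => hxv.
    have hx : h x = h X by have := c_le2 x; lia.
    have [//|/cF1|/cF2] : [\/ x = X, F1 x | F2 x] by apply: FP.
      by lia.
    by lia.
  by apply: alone => //; have := c_le2 x; lia.
- move=> x Sx nx; have xX : x <> X by move=> e; apply: nx; left.
  have nVx : ~ V x by move=> Vx; apply: nx; right.
  have [Fx|nFx] := pselect (F x); last first.
    apply: sub_infinite_set (inf x Sx nVx) => y [Sy hy]; split=> //.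
    by rewrite /h' hy !cF // => -[_]; rewrite ?hy => hx; apply: nFx.
  have hx : h x = h X by case: Fx.
  have [//|F1x|F2x] := FP _ Fx.
    apply: sub_infinite_set infF1 => y F1y; have [[Sy hy] _] := F1F _ F1y.
    by split=> //; rewrite /h' hy hx !cF1.
  apply: sub_infinite_set infF2 => y F2y; have [[[Sy hy] _] _] := F2y.
  by split=> //; rewrite /h' hy hx !cF2.
(* [x1] and [x2] lie just below and just above [X]; by [nhX] the older vertices are outside the
   class of [X]. *)
- have nx1 : ~ (X |` V) x1 by move=> [].
  have nx2 : ~ (X |` V) x2 by move=> [].
  have nhX v : V v -> h v <> h X.
    by move=> Vv hv; apply: (VF v Vv); split=> //; exact: VS.
  move=> u v [->|Vu] [->|Vv]; rewrite /h' ?cX ?(cV _ Vu) ?(cV _ Vv) => uv.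
  + by lia.
  + by exists x2; split=> //; have := nhX _ Vv; lia.
  + by exists x1; split=> //; have := nhX _ Vu; lia.
  + have [x [Sx nVx /andP[ux xv]]] :
        exists x, [/\ S x, ~ V x & h u < h x < h v].
      by apply: btw => //; lia.
    (* [x] might be [X], now a vertex; [x1], from the same class, serves instead. *)
    have [Fx|nFx] := pselect (F x).
      by exists x1; split=> //; case: Fx => _; lia.
    exists x; split=> //; last by rewrite (cF _ nFx); lia.
    by move=> [xX|//]; apply: nFx; rewrite xX.
- by move=> v Vv; right.
- by left.
- move=> u v Vu Vv; rewrite /h' (cV _ Vu) (cV _ Vv); split; first by lia.
  congr Figure; apply/seteqP; split=> x [Sx uxv]; split=> //;
    rewrite (cV _ Vu) (cV _ Vv) in uxv *.
    by have := c_le2 x; lia.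
  (* Only at the top rank could the offset push a point out of the interval, but there [v] is alone
     and has offset 0. *)
  have [hxv|hxv] := eqVneq (h x) (h v); last by have := c_le2 x; lia.
  by rewrite (alone v x Vv Sx hxv) (cV _ Vv); lia.
Qed.

(** As a vertex, [X] is alone in its rank, so the two pieces meet only in [X], an end of both. *)
Lemma interval_decomposition h V u X v : ranking h V ->
  V u -> V X -> V v -> h u < h X < h v ->
  decomposition (interval h u v) X [set interval h u X; interval h X v].
Proof.
move=> rk Vu VX Vv /andP[uX Xv].
have [VS alone _ _] := rk.
have neqLR : interval h u X <> interval h X v.
  move=> /(congr1 (fun L : obj P 1 => elements L u)) /=.
  by rewrite propeqE => -[/(_ (conj (VS _ Vu) _))]; lia.
have meetX x :
    elements (interval h u X) x -> elements (interval h X v) x -> x = X.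
  by move=> [Sx ux] [_ xv]; apply: alone VX Sx _; lia.
have [Su SX Sv] : [/\ S u, S X & S v] by split; exact: VS.
have uL : elements (interval h u X) u by split=> //; lia.
have XL : elements (interval h u X) X by split=> //; lia.
have XR : elements (interval h X v) X by split=> //; lia.
have vR : elements (interval h X v) v by split=> //; lia.
have nuR : ~ elements (interval h X v) u by move=> [_]; lia.
have nvL : ~ elements (interval h u X) v by move=> [_]; lia.
split.
- apply/seteqP; split=> [x [L [->|->] [Sx hx]]|x [Sx hx]];
    try by split=> //; lia.
  have [xX|Xx] := leqP (h x) (h X).
    by exists (interval h u X); [left|split=> //; lia].
  by exists (interval h X v); [right|split=> //; lia].
- move=> L R [->|->] [->|->] // _ x [xL xR]; first by right; exact: meetX.
  by left; exact: meetX.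
- apply/seteqP; split=> [x [L [[->|->] [->|->] uniq]]|x [->|->]].
  + by left.
  + by case: neqLR; apply/esym/uniq => //; right.
  + by case: neqLR; apply: uniq => //; left.
  + by right.
  + by exists (interval h u X); split; [left|left|move=> R [->|->]].
  + by exists (interval h X v); split; [right|right|move=> R [->|->]].
- move=> L x DL Ex nEx; exists (interval h u X), (interval h X v); split=> //.
  have -> : x = X by case: DL Ex nEx => -> [->|->] //= []; [left|right].
  by apply/seteqP; split=> [R []//|R [->|->]]; split; [left| |right|].
- exists (interval h u X); split; [by left|by right|].
  by move=> [] e; move: uX Xv; rewrite ?e; lia.
(* [u] lies in the left piece only and [v] in the right one only, so neither piece can belong to
   [D']. *)
- move=> [D' [[L D'L] sub cyc]].
  have nLD : ~ D' (interval h u X).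
    by move=> DL; have [|R [D'R]] := cyc _ u DL;
      [left|case: (sub R D'R) => ->].
  have nRD : ~ D' (interval h X v).
    by move=> DR; have [|R [D'R]] := cyc _ v DR;
      [right|case: (sub R D'R) => ->].
  by have /sub[e|e] := D'L; rewrite e in D'L.
Qed.

(** The collection witnessing the greatest fixed point consists of all ranked arrays on [S]; it
    allows any point of [S] to be made a vertex. *)
Lemma ranked_array_consistent h V :
  ranking h V -> consistent (ranked_array h V).
Proof.
move=> rk0; exists [set W | exists h V, ranking h V /\ W = ranked_array h V].
split; last by exists h, V.
move=> {h V rk0} _ [h [V [rk ->]]]; have [VS alone inf btw] := rk; split.
- by move=> [|n] //= L x [u [v [_ _ _ ->]]] [].
- move=> [|n] //= L [u [v [Vu Vv uv ->]]].
  have [x [Sx nVx uxv]] := btw u v Vu Vv uv.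
  split.
  + apply: card_le_trans (subset_card_le (@subsetT _ _)) _.
    (* The whole infinite class of [x] lies in the interval. *)
    apply/infiniteP; apply: sub_infinite_set (inf x Sx nVx) => y [Sy hy].
    by split=> //; lia.
  + by move=> X Y _ _ _ p [pX _]; apply: no_part_point pX.
  + by exists u, v; split=> // e; rewrite e ltnn in uv.
  + by move=> y [->|->]; split; [exact: VS|lia|exact: VS|lia].
  + move=> X [[SX uXv] nEX].
    (* Refining at [X] keeps the interval from [u] to [v], so [X] stays in it, and strictly inside
       because the end vertices are alone. *)
    have [h' [V' [rk' VV' V'X old]]] := ranking_refine rk SX.
    have [uv' eqI] := old u v Vu Vv.
    have uXv' : h' u < h' X < h' v.
      have [_ uXv'] : elements (interval h' u v) X by rewrite eqI.
      have alone' w : V w -> h' X = h' w -> X = w.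
        by move=> Vw; apply: (vertex_alone rk') => //; exact: VV'.
      have uX : h' X <> h' u by move=> /(alone' _ Vu) e; apply: nEX; left.
      have vX : h' X <> h' v by move=> /(alone' _ Vv) e; apply: nEX; right.
      by lia.
    have /andP[uX' Xv'] := uXv'.
    exists [set interval h' u X; interval h' X v]; split; last first.
      rewrite -eqI; apply: (interval_decomposition rk') => //; exact: VV'.
    exists (ranked_array h' V'); split; first by exists h', V'.
      move=> [[|[|n]]] //= R [a [b [Va Vb ab ->]]].
      have [ab' eqab] := old a b Va Vb.
      by exists a, b; rewrite ab' eqab; split=> //; exact: VV'.
    move=> _ [T [->|->] <-] /=.
      by exists u, X; split=> //; exact: VV'.
    by exists X, v; split=> //; exact: VV'.
- move=> [|n] //= L T T' _ [a [b [Va Vb ab ->]]].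
  move=> [a' [b' [Va' Vb' ab' ->]]] _ _ /= E.
  (* The pairs of ends agree as sets; a swap would contradict [h a < h b] and [h a' < h b']. *)
  have [ea|ea] : [set a'; b'] a by rewrite -E; left.
    have [eb|->] : [set a'; b'] b by rewrite -E; right.
      by rewrite ea eb ltnn in ab.
    by rewrite ea.
  have [eb|eb] : [set a'; b'] b by rewrite -E; right.
    by rewrite ea eb ltnNge ltnW in ab.
  by rewrite ea eb ltnn in ab.
Qed.

(** The coarsest ranking: [A] at 0, [B] at 2, all other points tied at 1. *)
Lemma ranking_line A B : A <> B -> S A -> S B -> infinite_set S ->
  exists h, [/\ ranking h [set A; B], h A < h B
    & elements (interval h A B) = S].
Proof.
move=> AB SA SB infS.
pose h x := if pselect (x = A) then 0 else if pselect (x = B) then 2 else 1.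
have hA : h A = 0 by rewrite /h; case: pselect.
have hB : h B = 2 by rewrite /h; case: pselect => [/esym//|?]; case: pselect.
have hI x : ~ [set A; B] x -> h x = 1.
  move=> nx; rewrite /h; case: pselect => [e|?]; first by case: nx; left.
  by case: pselect => [e|//]; case: nx; right.
have infI : infinite_set (S `\` [set A; B]).
  by apply: infinite_setD => //; exact: finite_set2.
exists h; split; [split| |].
- by move=> x [->|->].
- move=> v x [->|->] _;
    have [[->|->]|/hI] := pselect ([set A; B] x); rewrite ?hA ?hB //; lia.
- move=> x Sx nx; apply: sub_infinite_set infI => y [Sy ny]; split=> //.
  by rewrite !hI.
- have [x [Sx nx]] := infinite_setN0 infI.
  move=> u v [->|->] [->|->]; rewrite ?hA ?hB // => _.
  by exists x; split=> //; rewrite hI.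
- by rewrite hA hB.
- apply/seteqP; split=> [x []//|x Sx]; split=> //; rewrite hA hB.
  by rewrite /h; do !case: pselect.
Qed.

End Ranking.

(** * The cut of a fundamental line at an inner point *)

Theorem theorem1p2 (P : Type) (A B C : P) (AB : obj P 1)
    (hAB : fundamental_line AB A B)
    (hC : elements AB C) (hCE : ~ E_objects AB C) :
  exists AC CB : obj P 1,
    [/\ fundamental_line AC A C /\ fundamental_line CB C B,
        within AC AB /\ within CB AB,
        elements AC `|` elements CB = elements AB,
        elements AC `&` elements CB = [set C]
      & can_assert [set mk AB] [set mk AC; mk CB]].
Proof.
have [ser EAB] := hAB.
have infS := seriate_infinite ser.
have [_ _ [a [b [neq_ab Eab]]] sub _] := ser.
have SA : elements AB A by apply: sub; rewrite EAB; left.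
have SB : elements AB B by apply: sub; rewrite EAB; right.
have neqAB : A <> B.
  move=> eqAB; have ab : [set A; B] a /\ [set A; B] b.
    by rewrite -EAB Eab; split; [left|right].
  by apply: neq_ab; case: ab; rewrite eqAB => -[->|->] [->|->].
have [h0 [rk0 lt0 all0]] := ranking_line neqAB SA SB infS.
have [h [V [rk VV VC old]]] := ranking_refine rk0 hC.
have [lt eqI] := old A B (or_introl erefl) (or_intror erefl).
have [VA VB] : V A /\ V B by split; apply: VV; [left|right].
set S := elements AB in all0 rk eqI *.
(* The given line is itself an interval, as a figure, and so belongs to the array [W]. *)
have eqAB : AB = interval S h A B.
  rewrite eqI; move: all0 EAB; rewrite /S; case: (AB) => e E /= all0 ->.
  by rewrite -[in LHS]all0.
have rank_le x : S x -> h A <= h x <= h B.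
  by rewrite -[S in S x]all0 -eqI => -[].
have [neqCA neqCB] : C <> A /\ C <> B.
  by split=> e; apply: hCE; rewrite EAB e; [left|right].
have /andP[ltAC ltCB] : h A < h C < h B.
  have := rank_le C hC.
  have hCA : h C <> h A by move=> /(vertex_alone rk VA hC).
  have hCB : h C <> h B by move=> /(vertex_alone rk VB hC).
  by lia.
(* [W] contains all three lines; its consistency makes both pieces seriate and jointly assertable
   given [AB]. *)
pose W := ranked_array S h V.
have conW : consistent W by exact: ranked_array_consistent.
have WAB : W (mk AB) by exists A, B; rewrite lt.
have WAC : W (mk (interval S h A C)) by exists A, C.
have WCB : W (mk (interval S h C B)) by exists C, B.
have dec := interval_decomposition rk VA VC VB (introT andP (conj ltAC ltCB)).
exists (interval S h A C), (interval S h C B); split.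
- by split; split=> //; apply: consistent_seriate conW _.
- by split=> x [].
- apply/seteqP; split=> [x [] []//|x Sx].
  by have /andP[Ax xB] := rank_le x Sx; have [xC|/ltnW Cx] := leqP (h x) (h C);
    [left|right]; split=> //; apply/andP.
- apply/seteqP; split=> [x [[Sx xC] [_ Cx]]|x ->].
    by apply: (vertex_alone rk VC Sx); lia.
  by split; split=> //; lia.
- by exists W; split=> [//|_ ->//|_ [->|->]].
Qed.
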